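(* Let $C\in(0,1)$. Then $$\lim_{N\rightarrow\infty} \mathbb{P}\left[\text{a random cubic graph on } 2N \text{ vertices contains a separating circuit of at most } C\log_2(N)\text{ edges}\right] = 0.$$
   Context: Random cubic graphs (configuration model): for $N\ge 1$ let $\Omega_N$ be the set of partitions of $\{1,\dots,6N\}$ into pairs, with the uniform probability measure $\mathbb{P}$. For $\omega\in\Omega_N$, $\Gamma(\omega)$ is the cubic multigraph (loops and multiple edges allowed) with vertices $1,\dots,2N$, where vertex $i$ carries the half-edges $3i-2,3i-1,3i$, and two half-edges are joined to an edge if they form a pair of $\omega$. A random cubic graph on $2N$ vertices is $\Gamma(\omega)$ for $\omega$ random in $\Omega_N$. A circuit is a closed path without repeated vertices (a loop has length $1$, a double edge gives a circuit of length $2$). A circuit is separating if, after removing its edges from the graph (keeping its vertices, which then have degree $1$), the vertices of the circuit do not all lie in the same connected component of the remaining graph. *)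

(* Defs.v *)
From HB Require Import structures.
From mathcomp Require Import all_boot all_order all_algebra.
From mathcomp Require Import boolp classical_sets reals topology normedtype.
From mathcomp Require Import sequences exp.

Set Implicit Arguments.
Unset Strict Implicit.
Unset Printing Implicit Defensive.

Import Order.TTheory GRing.Theory Num.Theory.
Import numFieldNormedType.Exports.

(* Everything is indexed from 0: half-edges 0, ..., 6N - 1 and vertices        *)
(* 0, ..., 2N - 1, vertex i carrying the half-edges 3i, 3i + 1, 3i + 2.        *)
Definition halfedge (N : nat) : finType := 'I_(6 * N).
Definition vertex (N : nat) : finType := 'I_(2 * N).

Lemma vertex_of_subproof N (h : 'I_(6 * N)) : h %/ 3 < 2 * N.
Proof. by rewrite ltn_divLR // mulnAC. Qed.

Definition vertex_of N (h : halfedge N) : vertex N :=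
  Ordinal (vertex_of_subproof h).

Definition Omega (N : nat) : {set {set {set halfedge N}}} :=
  [set w | finset.partition w [set: halfedge N] & [forall e in w, #|e| == 2]].

Definition adj N (E : {set {set halfedge N}}) : rel (vertex N) :=
  fun u v => [exists h, exists h' : halfedge N,
    [&& vertex_of h == u, vertex_of h' == v & [set h; h'] \in E]].

(* A step (h, h') of a path traverses the edge [set h; h'], leaving the vertex *)
(* that carries h and arriving at the vertex that carries h'.                  *)
Definition step (N : nat) : finType := (halfedge N * halfedge N)%type.
Definition edge N (d : step N) : {set halfedge N} := [set d.1; d.2].
Definition source N (d : step N) : vertex N := vertex_of d.1.
Definition target N (d : step N) : vertex N := vertex_of d.2.

(* The condition on edges only matters in length 2, where it excludes going    *)
(* back and forth along a single edge.                                         *)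
Definition circuit N (w : {set {set halfedge N}}) (c : seq (step N)) : bool :=
  [&& c != [::],
      all (fun d => edge d \in w) c,
      cycle (fun d d' => target d == source d') c,
      uniq (map (@source N) c) &
      uniq (map (@edge N) c)].

Definition remove_edges N (w : {set {set halfedge N}}) (c : seq (step N)) :
    {set {set halfedge N}} :=
  w :\: [set e in map (@edge N) c].

Definition separating N (w : {set {set halfedge N}}) (c : seq (step N)) : bool :=
  ~~ all2rel (connect (adj (remove_edges w c))) (map (@source N) c).

Local Open Scope ring_scope.

Definition log2 (R : realType) (x : R) : R := ln x / ln 2.

Definition has_short_separating_circuit (R : realType) (C : R) (N : nat)
    (w : {set {set halfedge N}}) : Prop :=
  exists c : seq (step N),
    [/\ circuit w c, separating w c & (size c)%:R <= C * log2 N%:R].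

Definition Prob (R : realType) (N : nat) (A : {set {set halfedge N}} -> Prop) : R :=
  #|[set w in Omega N | `[< A w >]]%SET|%:R / #|Omega N|%:R.

(* Main.v *)
Require Import Defs.
From HB Require Import structures.
From mathcomp Require Import all_boot all_order all_algebra zify.

(* First moment over pairs (circuit c, set S of vertices). If c has k edges    *)
(* and separates, some S with |S| = 2s <= N meets the vertex set W of c        *)
(* without containing it and is closed under the edges outside c. Given c and  *)
(* J = S :&: W, |J| = j, there are C(2N - k, 2s - j) such S, and for each the  *)
(* 6N - 2k half-edges outside c are matched inside and outside S separately.   *)
(* Write m(2a) = (2a - 1)!! for the number of matchings of 2a points. From     *)
(* m(2a) m(2b) C(a + b, a) <= m(2a + 2b) with a = 3s - j, a + b = 3N - k, and  *)
(* C(3N - k, 3s - j) >= C(N, s) C(2N - k, 2s - j) (Vandermonde), the pair      *)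
(* (s, J) contributes probability at most 1 / C(N, s). At s = 1 at most k^2    *)
(* sets J are possible, otherwise at most 2^k, so c separates with conditional *)
(* probability O(k^2 / N + 2^k / N^2). The expected number of circuits of      *)
(* length k is O(2^k), and 2^k <= N^C with C < 1.                              *)

Set Implicit Arguments.
Unset Strict Implicit.
Unset Printing Implicit Defensive.

(** Separation costs more than short circuits can pay for. There are at most (12N)^k closed walks of
    length k ([card_closed_walks]), so the expected number of circuits of length k is O(2^k) by
    [card_closed_walks_nmatchings]. Once the edges of a circuit with vertex set W are fixed, the
    other half-edges are matched uniformly, and separation forces a set S of at most half the
    vertices that splits W and that no remaining edge leaves ([separating_closed_set]).

    The key estimate is [sum_weight_trace]: all S with 2s vertices and a prescribed trace on W
    together have probability at most 1 / C(N, s). Sets of two vertices have only O(k^2) traces and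
    cost 1 / N; larger ones may have 2^k traces but cost O(1 / N^2) in total ([sum_weight_le]).

    Summing over k up to K = floor(C log2 N) gives a bound of order (K + 1) (2^K / N) (K^2 + 2^K /
    N) ([card_short_separating]). As 2^K is at most N^C with C < 1, this tends to 0; [Prob_le_ln]
    records the weaker rate O(1 / ln N). Here [nmatchings n] counts the perfect matchings of n
    points, hence is 0 for odd n. *)

(** * Double factorials and binomial coefficients *)

Fixpoint nmatchings (n : nat) : nat :=
  match n with
  | 0 => 1
  | 1 => 0
  | m.+2 => m.+1 * nmatchings m
  end.

Lemma nmatchings_double_gt0 a : 0 < nmatchings a.*2.
Proof. by elim: a => //= a IH; rewrite muln_gt0 IH. Qed.

Lemma nmatchings_odd n : odd n -> nmatchings n = 0.
Proof.
elim/ltn_ind: n => -[|[|n]] IH //= on.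
by rewrite IH ?muln0 //; lia.
Qed.

(** Double induction. Pascal's rule splits the binomial into two terms, which the induction
    hypotheses bound by 2a + 1 and 2b + 1 times the same matching number, while the right side grows
    by the larger factor 2a + 2b + 3. *)
Lemma nmatchings_split a b :
  nmatchings a.*2 * nmatchings b.*2 * 'C(a + b, a) <= nmatchings (a + b).*2.
Proof.
elim: a b => [|a IHa] b; first by rewrite bin0 mul1n muln1.
elim: b => [|b IHb]; first by rewrite !addn0 binn !muln1.
have Ha := IHa b.+1; rewrite addSn addnS binS !doubleS /=.
rewrite !addnS !addSn !doubleS /= in Ha IHb *.
set P := nmatchings _ in Ha IHb *; set Q := nmatchings _ in Ha IHb *.
set X := nmatchings _ in Ha IHb *; set c1 := 'C(_, _) in Ha IHb *.
set c2 := 'C(_, _) in Ha IHb *; nia.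
Qed.

Lemma leq_mul_bin m n i j : 'C(m, i) * 'C(n, j) <= 'C(m + n, i + j).
Proof.
rewrite -binomial.Vandermonde.
have hi : i < (i + j).+1 by rewrite ltnS leq_addr.
by rewrite (bigD1 (Ordinal hi)) //= addKn leq_addr.
Qed.

Lemma leq_bin_half n i j : i <= j -> j.*2 <= n -> 'C(n, i) <= 'C(n, j).
Proof.
elim: j => [|j IH]; first by rewrite leqn0 => /eqP ->.
rewrite leq_eqVlt => /orP[/eqP -> //|ij] hj.
apply: leq_trans (IH ij _) _; first lia.
have := mul_bin_left n j; nia.
Qed.

(** The ratio of the two matching numbers is the product of n - (2i + 1) over i < k, and the odd
    numbers 2i + 1 sum to k^2. So this is the estimate of a product of factors 1 - x_i from below by
    1 minus the sum of the x_i. *)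
Lemma nmatchings_removed_pairs n k : k.*2 <= n ->
  (n - k ^ 2) * n ^ k * nmatchings (n - k.*2) <= n * nmatchings n.
Proof.
elim: k => [|k IH] hk; first by rewrite exp0n // expn0 muln1 double0 !subn0.
have {}IH := IH ltac:(lia).
case: (leqP n (k.+1 ^ 2)) => [|hn]; first by rewrite -subn_eq0 => /eqP ->.
apply: leq_trans IH.
have -> : n - k.*2 = (n - k.+1.*2).+2 by lia.
have key : (n - k.+1 ^ 2) * n <= (n - k ^ 2) * (n - k.+1.*2).+1.
  have [-> ->] : n - k ^ 2 = n - k.+1 ^ 2 + (k.*2).+1 /\
    (n - k.+1.*2).+1 = n - k.+1 ^ 2 + k ^ 2 by nia.
  have hd : n = n - k.+1 ^ 2 + (k ^ 2 + (k.*2).+1) by nia.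
  rewrite [X in _ * X <= _]hd; set d := n - _; nia.
rewrite /= (expnS n); set P := nmatchings _; set q := n ^ k.
have -> : (n - k.+1 ^ 2) * (n * q) * P = (n - k.+1 ^ 2) * n * (q * P) by rewrite !mulnA.
by rewrite -[X in _ <= X]mulnA (mulnCA q) [X in _ <= X]mulnA leq_mul2r key orbT.
Qed.

Lemma sqr_le_3exp2 k : k ^ 2 <= 3 * 2 ^ k.
Proof.
elim/ltn_ind: k => -[|[|[|k]]] //= IH.
have := IH k.+1 ltac:(lia); rewrite !expnS expn0; nia.
Qed.

(** * Counting perfect matchings of a finite set *)

Section Matchings.
Variable T : finType.
Implicit Types (A B X e : {set T}) (w E : {set {set T}}).

(** [Omega N] is the case of the full set of half-edges, by conversion; smaller sets [A] appear once
    the edges of a circuit are removed. *)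
Definition matchings A : {set {set {set T}}} :=
  [set w | finset.partition w A & [forall e in w, #|e| == 2]].

Lemma matchingsP A w :
  reflect [/\ cover w = A, {in w &, forall e f, e != f -> [disjoint e & f]}
            & {in w, forall e, #|e| = 2}] (w \in matchings A).
Proof.
rewrite inE; apply: (iffP andP) => [[/and3P[/eqP cw /trivIsetP tw _] /'forall_in_eqP hw]|].
  by split.
case=> cw tw hw; split; last exact/'forall_in_eqP.
apply/and3P; split; [exact/eqP| exact/trivIsetP |].
by apply/negP => /hw; rewrite cards0.
Qed.

Lemma matchings_diff A w E : w \in matchings A -> E \subset w ->
  w :\: E \in matchings (A :\: cover E).
Proof.
move=> /matchingsP[cw tw hw] /subsetP sE; apply/matchingsP; split.
- apply/setP => x; rewrite -cw inE; apply/bigcupP/andP.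
    case=> e /setDP[ew eE] xe; split; last by apply/bigcupP; exists e.
    apply/bigcupP => -[f fE xf].
    have ef : e != f by apply: contraNneq eE => ->.
    by have /disjointFr := tw _ _ ew (sE _ fE) ef => /(_ x xe); rewrite xf.
  case=> xE /bigcupP[e ew xe]; exists e => //; rewrite inE ew andbT.
  by apply: contra xE => eE; apply/bigcupP; exists e.
- by move=> e f /setDP[ew _] /setDP[fw _]; exact: tw.
- by move=> e /setDP[ew _]; exact: hw.
Qed.

Lemma matchings_add A w e : w \in matchings A -> #|e| = 2 -> [disjoint e & A] ->
  e |: w \in matchings (e :|: A) /\ e \notin w.
Proof.
move=> /matchingsP[cw tw hw] he dA.
have df f : f \in w -> [disjoint e & f].
  move=> fw; apply: disjointWr dA; rewrite -cw.
  by apply/subsetP => x xf; apply/bigcupP; exists f.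
split; last first.
  apply/negP => /df; rewrite -setI_eq0 setIid => /eqP e0.
  by rewrite e0 cards0 in he.
apply/matchingsP; split.
- by rewrite /cover bigcup_setU big_set1 -[in RHS]cw.
- move=> f g /setU1P[->|fw] /setU1P[->|gw]; rewrite ?eqxx //.
  + by move=> _; exact: df.
  + by move=> _; rewrite disjoint_sym; exact: df.
  + exact: tw.
- by move=> f /setU1P[->|/hw].
Qed.

Lemma card_matchings_with A e : e \subset A -> #|e| = 2 ->
  #|[set w in matchings A | e \in w]| = #|matchings (A :\: e)|.
Proof.
move=> eA he.
have de : [disjoint e & A :\: e].
  by rewrite -setI_eq0 setIDA setIC -setIDA setDv setI0.
have eU : e :|: (A :\: e) = A.
  by apply/setP => x; rewrite !inE; case: (boolP (x \in e)) => // /(subsetP eA) ->.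
rewrite -[RHS](@card_in_imset _ _ (fun w => e |: w)); last first.
  move=> w w' hw hw' eww'.
  have [_ /setU1K <-] := matchings_add hw he de.
  by have [_ /setU1K <-] := matchings_add hw' he de; rewrite eww'.
apply: eq_card => w; rewrite in_set; apply/andP/imsetP.
  case=> wA ew; exists (w :\ e); last by rewrite setD1K.
  have := matchings_diff (E := [set e]) wA; rewrite sub1set => /(_ ew).
  by rewrite /cover big_set1.
case=> w' hw' ->; rewrite setU11; split=> //.
by have [] := matchings_add hw' he de; rewrite eU.
Qed.

(** Fix a point [x] and sort the matchings by its partner [y]: each of the #|A| - 1 partners leaves
    a matching of #|A| - 2 points. *)
Lemma card_matchings A : #|matchings A| = nmatchings #|A|.
Proof.
have [n] := ubnP #|A|; elim: n A => // n IH A; rewrite ltnS => leA.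
have [->|[x xA]] := set_0Vmem A.
  rewrite cards0 /= -(cards1 (set0 : {set {set T}})); apply: eq_card => w.
  rewrite inE partition_set0 in_set1 -[LHS]/(_ && _).
  by apply: andb_idr => /eqP ->; apply/'forall_in_eqP => e; rewrite inE.
have part w : w \in matchings A ->
    \sum_(y in A :\ x) ([set x; y] \in w : nat) = 1.
  move=> /matchingsP[cw tw hw].
  have /bigcupP[e ew xe] : x \in cover w by rewrite cw.
  have /eqP := hw _ ew; rewrite (cardsD1 x) xe eqSS => /cards1P[y ey].
  have eE : e = [set x; y] by rewrite -(setD1K xe) ey.
  have : y \in e :\ x by rewrite ey set11.
  rewrite in_setD1 => /andP[yx ye].
  have yA : y \in A by rewrite -cw; apply/bigcupP; exists e.
  rewrite (bigD1 y) ?in_setD1 ?yx //= -eE ew big1 // => z /andP[_ zy].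
  case: (boolP (_ \in w)) => // zw.
  have : e != [set x; z].
    apply: contraNneq zy => eq; move: ye; rewrite eq in_set2 (negbTE yx) /=.
    by rewrite eq_sym.
  by move=> /(tw _ _ ew zw) /disjointFr /(_ xe); rewrite set21.
have -> : #|matchings A| =
    \sum_(y in A :\ x) #|[set w in matchings A | [set x; y] \in w]|.
  rewrite -sum1_card -(eq_bigr _ part) exchange_big; apply: eq_bigr => y _.
  by rewrite -sum1dep_card big_mkcondr.
have cA : #|A| = #|A :\ x|.+1 by rewrite (cardsD1 x) xA.
have cxy y : y \in A :\ x -> #|A :\: [set x; y]|.+2 = #|A|.
  move=> yA; rewrite cA; congr _.+1.
  by rewrite (cardsD1 y (A :\ x)) yA setDDl.
transitivity (\sum_(y in A :\ x) nmatchings (#|A| - 2)).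
  apply: eq_bigr => y yA; have := cxy _ yA.
  move: yA; rewrite in_setD1 => /andP[yx yA] cy.
  rewrite card_matchings_with ?cards2 1?eq_sym ?yx //; last first.
    by rewrite subUset !sub1set xA.
  by rewrite IH -?cy ?subn2 //; apply: leq_trans leA; rewrite -cy ltnW.
rewrite sum_nat_const cA; case: #|A :\ x| => [|m] //=.
by rewrite subn2.
Qed.

(** Such a matching is determined by its pairs inside [X] and its pairs off [X], which are matchings
    of the two parts of [A]. *)
Lemma card_matchings_closed A X :
  #|[set w in matchings A | [forall e in w, (e \subset X) || [disjoint e & X]]]|
    <= nmatchings #|A :&: X| * nmatchings #|A :\: X|.
Proof.
rewrite -!card_matchings -cardsX.
pose f w := ([set e in w | e \subset X], [set e in w | ~~ (e \subset X)]).
rewrite -(@card_in_imset _ _ f); last first.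
  move=> w w' _ _ [/setP h1 /setP h2]; apply/setP => e.
  by have := h1 e; have := h2 e; rewrite !inE; case: (e \subset X); rewrite ?andbT.
apply: subset_leq_card; apply/subsetP => _ /imsetP[w + ->].
rewrite inE => /andP[/matchingsP[cw tw hw] /'forall_in_orP cl].
rewrite in_setX; apply/andP; split; apply/matchingsP; split.
- apply/setP => x; rewrite inE -cw; apply/bigcupP/andP.
    case=> e; rewrite inE => /andP[ew /subsetP eX] xe; split; last exact: eX.
    by apply/bigcupP; exists e.
  case=> /bigcupP[e ew xe] xX; exists e => //; rewrite inE ew /=.
  by case: (cl e ew) => // /disjointFr/(_ xe); rewrite xX.
- by move=> e g; rewrite !inE => /andP[ew _] /andP[gw _]; exact: tw.
- by move=> e; rewrite !inE => /andP[ew _]; exact: hw.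
- apply/setP => x; rewrite inE -cw; apply/bigcupP/andP.
    case=> e; rewrite inE => /andP[ew eX] xe; split; last first.
      by apply/bigcupP; exists e.
    by case: (cl e ew) => [h|/disjointFr -> //]; rewrite h in eX.
  case=> xX /bigcupP[e ew xe]; exists e => //; rewrite inE ew /=.
  by apply: contra xX => /subsetP; exact.
- by move=> e g; rewrite !inE => /andP[ew _] /andP[gw _]; exact: tw.
- by move=> e; rewrite !inE => /andP[ew _]; exact: hw.
Qed.

Lemma card_matchings_containing_closed A E X :
  #|[set w in matchings A | E \subset w &
      [forall e in w :\: E, (e \subset X) || [disjoint e & X]]]|
    <= nmatchings #|(A :\: cover E) :&: X| * nmatchings #|(A :\: cover E) :\: X|.
Proof.
apply: leq_trans (card_matchings_closed _ _).
rewrite -(@card_in_imset _ _ (fun w => w :\: E)); last first.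
  move=> w w'; rewrite !inE => /and3P[_ Ew _] /and3P[_ Ew' _] eww'.
  by rewrite -(setID w E) -(setID w' E) eww' (setIidPr Ew) (setIidPr Ew').
apply: subset_leq_card; apply/subsetP => _ /imsetP[w + ->].
rewrite inE => /and3P[wA Ew cl]; rewrite inE cl andbT.
exact: matchings_diff.
Qed.

End Matchings.

(** * General counting tools *)

Lemma uniq_map_inj (T1 T2 : eqType) (f : T1 -> T2) (s : seq T1) :
  uniq (map f s) -> {in s &, injective f}.
Proof.
elim: s => //= x s IH /andP[fx us] y z; rewrite !inE.
move=> /orP[/eqP->|ys] /orP[/eqP->|zs] //; last exact: IH.
  by move=> fxz; rewrite fxz map_f in fx.
by move=> fyx; rewrite -fyx map_f in fx.
Qed.

Lemma card_set_count (T : finType) (s : seq T) (P : pred T) :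
  uniq s -> #|[set x in s | P x]| = count P s.
Proof.
move=> us; rewrite -size_filter -(card_uniqP (filter_uniq P us)).
by apply: eq_card => x; rewrite inE mem_filter andbC.
Qed.

Lemma card_all_tuples (T : finType) (D : {set T}) k :
  #|[set t : k.-tuple T | all (mem D) t]| <= #|D| ^ k.
Proof.
rewrite -[k in _ ^ k]card_ord -card_ffun_on.
pose f (t : k.-tuple T) := [ffun i => tnth t i].
rewrite -(@card_imset _ _ f); last first.
  by move=> t u /ffunP h; apply: eq_from_tnth => i; have := h i; rewrite !ffunE.
apply: subset_leq_card; apply/subsetP => _ /imsetP[t + ->].
rewrite inE => /allP ht; apply/ffun_onP => i; rewrite ffunE.
by apply: ht; exact: mem_tnth.
Qed.

(** The union bound. *)
Lemma card_le_sum (T I : finType) (A : {set T}) (P : pred I) (F : I -> {set T}) :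
  (forall x, x \in A -> exists2 i, P i & x \in F i) ->
  #|A| <= \sum_(i | P i) #|F i|.
Proof.
move=> hA; apply: leq_trans (_ : \sum_(x in A) \sum_(i | P i) (x \in F i : nat) <= _).
  rewrite -sum1_card; apply: leq_sum => x /hA[i Pi xi].
  by rewrite (bigD1 i) //= xi.
rewrite exchange_big; apply: leq_sum => i _ /=.
rewrite -big_mkcondr sum1dep_card; apply: subset_leq_card.
by apply/subsetP => x; rewrite inE => /andP[].
Qed.

(** * Closed walks and closed vertex sets *)

Section CubicGraphs.
Variable N : nat.
Implicit Types (c : seq (step N)) (S J : {set vertex N}) (w : {set {set halfedge N}}).

Definition halfedges_at S : {set halfedge N} := @vertex_of N @^-1: S.
Definition edges c : {set {set halfedge N}} := [set e in map (@edge N) c].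
Definition vertices c : {set vertex N} := [set v in map (@source N) c].

(** The part of being a circuit that does not mention the matching, so that one can sum over walks
    first. Distinctness of all 2k half-edges ensures that prescribing the edges removes exactly 2k
    half-edges from the matching. *)
Definition closed_walk c :=
  [&& uniq (map fst c ++ map snd c), uniq (map (@source N) c)
    & map (@target N) c == rot 1 (map (@source N) c)].

Lemma card_fiber (v : vertex N) : #|[set h | vertex_of h == v]| = 3.
Proof.
have hlt (i : 'I_3) : 3 * v + i < 6 * N.
  by have := ltn_ord v; have := ltn_ord i; lia.
rewrite -[RHS](card_ord 3) -cardsT.
rewrite -[RHS](@card_imset _ _ (fun i => Ordinal (hlt i) : halfedge N)); last first.
  by move=> i j /(congr1 val)/= /addnI/val_inj.
apply: eq_card => h; rewrite inE; apply/eqP/imsetP => [hv|[i _ ->]].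
  exists (Ordinal (ltn_pmod h (isT : 0 < 3))) => //.
  by apply: val_inj => /=; rewrite -hv [LHS](divn_eq h 3) mulnC.
by apply: val_inj => /=; rewrite mulnC divnMDl // divn_small ?addn0.
Qed.

Lemma card_halfedges_at S : #|halfedges_at S| = 3 * #|S|.
Proof.
rewrite -sum1_card (partition_big (@vertex_of N) [in S]) /= => [|h]; last by rewrite inE.
rewrite [RHS]mulnC -sum_nat_const; apply: eq_bigr => v vS.
rewrite -[RHS](card_fiber v) sum1dep_card; apply: eq_card => h; rewrite !inE.
by apply: andb_idl => /eqP ->.
Qed.

Lemma target_circuit c : cycle (fun d d' => target d == source d') c ->
  map (@target N) c = rot 1 (map (@source N) c).
Proof.
case: c => //= d p; rewrite rot1_cons -map_rcons.
suff H (x y : step N) : path (fun d d' => target d == source d') x (rcons p y) ->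
    map (@target N) (x :: p) = map (@source N) (rcons p y) by exact: H.
elim: p x => [|z p IH] x /=; first by rewrite andbT => /eqP ->.
by move=> /andP[/eqP -> /IH /= ->].
Qed.

(** Distinct edges of [w] are disjoint and the edges of [c] are distinct, so two steps sharing a
    half-edge coincide; the two half-edges of one step differ because its edge has two elements. *)
Lemma circuit_closed_walk w c : w \in Omega N -> circuit w c -> closed_walk c.
Proof.
move=> /matchingsP[_ tw hw] /and5P[_ /allP cw cc us ue].
apply/and3P; split=> //; last by rewrite target_circuit.
have same d d' h : d \in c -> d' \in c -> h \in edge d -> h \in edge d' -> d = d'.
  move=> dc dc' hd hd'; apply: (uniq_map_inj ue) => //; apply/eqP/negPn/negP.
  by move=> /(tw _ _ (cw _ dc) (cw _ dc')) /disjointFr /(_ hd); rewrite hd'.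
have in1 (d : step N) : d.1 \in edge d by rewrite set21.
have in2 (d : step N) : d.2 \in edge d by rewrite set22.
have uc := map_uniq us.
rewrite cat_uniq; apply/and3P; split.
- rewrite map_inj_in_uniq // => d d' dc dc' e.
  by apply: (same _ _ d.1) => //; rewrite e.
- apply/hasPn => _ /mapP[d dc ->]; apply/mapP => -[d' dc' e].
  have dd' : d = d' by apply: (same _ _ d.2) => //; rewrite e.
  by have := hw _ (cw _ dc); rewrite /edge dd' -{2}dd' e setUid cards1.
- rewrite map_inj_in_uniq // => d d' dc dc' e.
  by apply: (same _ _ d.2) => //; rewrite e.
Qed.

Lemma card_vertices c : closed_walk c -> #|vertices c| = size c.
Proof. by case/and3P=> _ /card_uniqP us _; rewrite cardsE us size_map. Qed.

(** Each vertex of the walk carries one departing and one arriving half-edge of it, since the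
    targets are the sources rotated. *)
Lemma card_edges_halfedges c S : closed_walk c ->
  #|cover (edges c) :&: halfedges_at S| = 2 * #|S :&: vertices c|.
Proof.
move=> /and3P[uh us /eqP ts].
have -> : cover (edges c) :&: halfedges_at S =
    [set h in map fst c ++ map snd c | vertex_of h \in S].
  apply/setP => h; rewrite !inE mem_cat; congr (_ && _).
  apply/bigcupP/orP => [[e]|].
    rewrite inE => /mapP[d dc ->]; rewrite in_set2.
    by move=> /orP[]/eqP->; [left|right]; apply: map_f.
  by case=> /mapP[d dc ->]; exists (edge d);
    rewrite ?in_set2 ?eqxx ?orbT // inE map_f.
rewrite card_set_count // count_cat.
have -> : S :&: vertices c = [set v in map (@source N) c | v \in S].
  by apply/setP => v; rewrite !inE andbC.
rewrite card_set_count // mul2n -addnn; congr (_ + _).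
  by rewrite !count_map.
transitivity (count [in S] (map (@target N) c)); first by rewrite !count_map.
by rewrite ts; apply/permP; rewrite perm_rot.
Qed.

Lemma card_cover_edges c : closed_walk c -> #|cover (edges c)| = 2 * size c.
Proof.
move=> cc; rewrite -(card_vertices cc) -[vertices c]setTI -card_edges_halfedges //.
by rewrite /halfedges_at preimsetT setIT.
Qed.

(* A closed walk is determined by the pairs (arriving half-edge, leaving       *)
(* half-edge) at its successive vertices.                                      *)
Definition turns : {set step N} :=
  [set p : step N | (vertex_of p.1 == vertex_of p.2) && (p.1 != p.2)].

Lemma card_turns : #|turns| <= 12 * N.
Proof.
rewrite -sum1dep_card -(pair_big_dep xpredT
  (fun h h' : halfedge N => (vertex_of h == vertex_of h') && (h != h')) (fun _ _ => 1)) /=.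
apply: (@leq_trans (\sum_(h : halfedge N) 2)); last first.
  by rewrite sum_nat_const card_ord; lia.
apply: leq_sum => h _; rewrite sum1dep_card.
have [e] : 1 + #|[set h' | vertex_of h' == vertex_of h] :\ h| = 3.
  by rewrite -[RHS](card_fiber (vertex_of h)) [RHS](cardsD1 h) inE eqxx.
rewrite -[X in _ <= X]e; apply: subset_leq_card.
by apply/subsetP => h'; rewrite !inE eq_sym andbC (eq_sym h).
Qed.

Lemma card_closed_walks k :
  #|[set c : k.-tuple (step N) | closed_walk c]| <= (12 * N) ^ k.
Proof.
have leD : #|turns| ^ k <= (12 * N) ^ k.
  by case: k => // k; rewrite leq_exp2r // card_turns.
apply: leq_trans leD; apply: leq_trans (card_all_tuples turns k).
(* The i-th turn pairs the end of step i with the start of the cyclically next step; unzipping and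
   rotating back recovers [c]. *)
pose f (c : k.-tuple (step N)) :=
  [tuple of zip [tuple of map snd c] [tuple of rot 1 (map fst c)]].
rewrite -(@card_imset _ _ f); last first.
  move=> c d /(congr1 val)/= fcd; apply: val_inj => /=.
  have e2 : map snd c = map snd d.
    have := congr1 unzip1 fcd; rewrite !unzip1_zip //;
      by rewrite !(size_map, size_rot) ?size_tuple.
  have e1 : map fst c = map fst d.
    apply: (@rot_inj 1); have := congr1 unzip2 fcd; rewrite !unzip2_zip //;
      by rewrite !(size_map, size_rot) ?size_tuple.
  by rewrite -(zip_unzip c) -(zip_unzip d) /unzip1 /unzip2 e1 e2.
apply: subset_leq_card; apply/subsetP => _ /imsetP[c + ->].
rewrite !inE => /and3P[uh _ /eqP ts].
have szE : size (map snd c) = size (rot 1 (map fst c)) by rewrite size_rot !size_map.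
apply/allP => -[x y] /= /(nthP (x, y))[i hi]; rewrite nth_zip // => -[xi yi].
rewrite size_zip -szE minnn in hi.
have xc : x \in map snd c by rewrite -xi mem_nth.
have yc : y \in map fst c by rewrite -(mem_rot 1) -yi mem_nth // -szE.
rewrite inE; apply/andP; split; last first.
  apply: contraTneq uh => /= xy; rewrite cat_uniq; apply/and3P => -[_ /hasPn + _].
  by move=> /(_ _ xc); rewrite /= xy yc.
rewrite -[X in vertex_of X]xi -[X in _ == vertex_of X]yi /=.
rewrite -!(nth_map _ (vertex_of x)) -?szE // -map_rot -!map_comp.
by move: ts; rewrite -map_rot => <-.
Qed.

(** Take the component, after removal of the circuit, of a circuit vertex [u] that cannot reach
    another circuit vertex [v]. If it has more than N vertices, its complement serves instead, as
    the condition on edges is symmetric. *)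
Lemma separating_closed_set w c : w \in Omega N -> separating w c ->
  exists S, [/\ #|S| <= N, S :&: vertices c != set0, ~~ (vertices c \subset S) &
    [forall e in w :\: edges c,
       (e \subset halfedges_at S) || [disjoint e & halfedges_at S]]].
Proof.
move=> /matchingsP[_ _ hw] /allPn[u uc /allPn[v vc nuv]].
set E := w :\: edges c.
pose S := [set x | connect (adj (remove_edges w c)) u x].
have uS : u \in S by rewrite inE connect0.
have vS : v \notin S by rewrite inE.
have adjE h h' : [set h; h'] \in E -> adj (remove_edges w c) (vertex_of h) (vertex_of h').
  by move=> hE; apply/existsP; exists h; apply/existsP; exists h'; rewrite !eqxx.
have clS e : e \in E -> (e \subset halfedges_at S) || [disjoint e & halfedges_at S].
  move=> eE; have /eqP/cards2P[h [h' [_ eh]]] : #|e| = 2.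
    by apply: hw; move: eE => /setDP[].
  have hS : (vertex_of h \in S) = (vertex_of h' \in S).
    rewrite eh in eE; rewrite !inE; apply/idP/idP => k; apply: connect_trans k _;
      by apply/connect1/adjE; rewrite // setUC.
  rewrite eh subUset !sub1set disjoint_sym disjoints_subset.
  case: (boolP (vertex_of h \in S)) => k; apply/orP; [left|right].
    by rewrite !inE in hS k *; rewrite -hS k.
  apply/subsetP => x; rewrite !inE; apply: contraTN => /orP[]/eqP->.
    by rewrite inE in k.
  by rewrite hS inE in k.
have [leS|ltS] := leqP #|S| N.
  exists S; split=> //.
  - by apply/set0Pn; exists u; rewrite !inE connect0.
  - by apply/subsetPn; exists v; rewrite ?inE.
  - by apply/forall_inP.
exists (~: S); split.
- by have := cardsC S; rewrite card_ord; lia.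
- by apply/set0Pn; exists v; rewrite !inE vc andbT -[X in ~~ X]in_set.
- by apply/subsetPn; exists u; rewrite !inE ?connect0.
- apply/forall_inP => e /clS; rewrite /halfedges_at preimsetC.
  by rewrite !disjoints_subset setCK orbC.
Qed.

End CubicGraphs.

(** * Total weight of the closed sets that split a circuit *)

Section ClosedSets.
Variables (V : finType) (N : nat) (W : {set V}).
Hypothesis cardV : #|V| = 2 * N.
Implicit Types S J : {set V}.
Let k := #|W|.
Let P := nmatchings (6 * N - 2 * k).

(* Bounds the number of matchings off a circuit with vertex set W that keep S  *)
(* closed: each vertex of W has two of its three half-edges on the circuit.    *)
Definition weight S :=
  nmatchings (3 * #|S| - 2 * #|S :&: W|) *
  nmatchings (6 * N - 2 * k - (3 * #|S| - 2 * #|S :&: W|)).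

(** All these [S] have the same weight, and there are at most C(2N - k, 2s - #|J|) of them. The
    binomial C(3N - k, 3s - #|J|) gained from [nmatchings_split] absorbs this count and, by
    Vandermonde, leaves C(N, s) to spare. *)
Lemma sum_weight_trace J s :
  'C(N, s) * \sum_(S | (S :&: W == J) && (#|S| == s.*2)) weight S <= P.
Proof.
have lekV : k <= 2 * N by rewrite -cardV max_card.
pose Q S := (S :&: W == J) && (#|S| == s.*2).
rewrite (eq_bigl Q) //.
case: (pickP Q) => [S0 /andP[/eqP S0J /eqP cS0]|no]; last by rewrite big_pred0 ?muln0.
have leJ : #|J| <= s.*2 by rewrite -cS0 -S0J subset_leq_card ?subsetIl.
set m := 3 * s - #|J|; set n := 3 * N - k - m.
(* Any admissible [S] gives 2s + k - #|J| <= 2N from its union with [W], and s <= N; adding these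
   gives m <= 3N - k, so otherwise the sum is empty. *)
have [lemN|gtmN] := leqP m (3 * N - k); last first.
  rewrite big_pred0 ?muln0 // => S; apply/negbTE/negP => /andP[/eqP SJ /eqP cS].
  have : #|S :|: W| <= 2 * N by rewrite -cardV max_card.
  have : #|S| <= 2 * N by rewrite -cardV max_card.
  by rewrite cardsU SJ cS -/k; lia.
have wE S : Q S -> weight S = nmatchings m.*2 * nmatchings n.*2.
  by case/andP => /eqP SJ /eqP cS; rewrite /weight SJ cS; congr (nmatchings _ * nmatchings _); lia.
rewrite (eq_bigr _ wE) sum_nat_const.
have cQ : #|Q| <= 'C(2 * N - k, s.*2 - #|J|).
  have -> : 2 * N - k = #|~: W| by rewrite -cardV -(cardsC W) addKn.
  have -> : #|Q| = #|[set S | Q S]| by apply: eq_card => S; rewrite [RHS]inE.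
  rewrite -cards_draws -(@card_in_imset _ _ (fun S => S :\: W) [set S | Q S]); last first.
    move=> S S'; rewrite !inE => /andP[/eqP SJ _] /andP[/eqP SJ' _] SS'.
    by rewrite -(setID S W) -(setID S' W) SJ SJ' SS'.
  apply: subset_leq_card; apply/subsetP => _ /imsetP[S + ->].
  rewrite !inE => /andP[/eqP SJ /eqP cS]; apply/andP; split.
    by rewrite setDE subsetIr.
  by rewrite cardsD SJ cS.
have bin_le := leq_mul_bin N (2 * N - k) s (s.*2 - #|J|).
have := nmatchings_split m n.
have -> : (m + n).*2 = 6 * N - 2 * k by lia.
have -> : m + n = N + (2 * N - k) by lia.
have -> : m = s + (s.*2 - #|J|) by lia.
rewrite -/P -/m; apply: leq_trans.
rewrite mulnA mulnC leq_mul2l; apply/orP; right.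
by apply: leq_trans bin_le; rewrite leq_mul2l cQ orbT.
Qed.

Let layer s :=
  \sum_(J : {set V} | [&& J \subset W, J != set0 & #|J| <= s.*2])
    \sum_(S | (S :&: W == J) && (#|S| == s.*2)) weight S.

Lemma layer_le s (F : {set {set V}}) :
  (forall J, J \subset W -> J != set0 -> #|J| <= s.*2 -> J \in F) ->
  'C(N, s) * layer s <= #|F| * P.
Proof.
move=> hF; rewrite big_distrr /=.
apply: leq_trans (leq_sum _ (fun J _ => sum_weight_trace J s)) _.
rewrite sum_nat_const leq_mul2r; apply/orP; right.
by apply: subset_leq_card; apply/subsetP => J /and3P[? ? ?]; exact: hF.
Qed.

Lemma layer_le_exp s : 'C(N, s) * layer s <= 2 ^ k * P.
Proof.
rewrite -card_powerset; apply: layer_le => J JW _ _.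
by rewrite inE.
Qed.

(** A trace of a two-vertex set has one or two elements, and k + C(k, 2) <= k^2. *)
Lemma layer1_le : N * layer 1 <= k ^ 2 * P.
Proof.
rewrite -{1}[N]bin1.
pose F := [set J : {set V} | J \subset W & #|J| == 1] :|:
          [set J : {set V} | J \subset W & #|J| == 2].
apply: leq_trans (layer_le (F := F) _) _.
  move=> J JW J0 J2; rewrite !inE JW /=.
  by move: J0 J2; rewrite -card_gt0 -[1.*2]/2; lia.
rewrite leq_mul2r; apply/orP; right; apply: leq_trans (leq_card_setU _ _) _.
rewrite !cards_draws -/k bin1 bin2.
case: k => // n /=; have := odd_double_half (n.+1 * n); lia.
Qed.

(** If #|S| is odd, an odd number of half-edges at [S] remains to be matched inside and the weight
    vanishes. The other sets are sorted by half their size and by their trace on [W]. *)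
Lemma sum_weight_layers :
  \sum_(S : {set V} | [&& #|S| <= N, S :&: W != set0 & ~~ (W \subset S)]) weight S
    <= \sum_(s < N.+1 | (0 < s) && (s.*2 <= N)) layer s.
Proof.
rewrite (bigID (fun S : {set V} => odd #|S|)) /= big1 ?add0n => [|S /andP[_ oS]]; last first.
  rewrite /weight nmatchings_odd // oddB ?oddM /= ?oS //.
  by apply: leq_mul => //; rewrite subset_leq_card ?subsetIl.
have val_half S : #|S| <= N -> (inord #|S|./2 : 'I_N.+1) = #|S|./2 :> nat.
  by move=> SN; rewrite inordK //; lia.
rewrite (partition_big (fun S : {set V} => inord #|S|./2 : 'I_N.+1)
  (fun s => (0 < s) && (s.*2 <= N))) /=; last first.
  move=> S /andP[/and3P[SN + _] eS]; rewrite val_half // -card_gt0 => S0.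
  have : #|S :&: W| <= #|S| by rewrite subset_leq_card ?subsetIl.
  lia.
apply: leq_sum => s _; rewrite (partition_big (fun S : {set V} => S :&: W)
  (fun J => [&& J \subset W, J != set0 & #|J| <= s.*2])) /=; last first.
  move=> S /andP[/andP[/and3P[SN S0 _] eS] /eqP <-].
  rewrite subsetIr S0 val_half // even_halfK //.
  by rewrite subset_leq_card ?subsetIl.
apply: leq_sum => J _; rewrite big_mkcond [leqRHS]big_mkcond.
apply: leq_sum => S _; case: ifP => // /andP[/andP[/andP[/and3P[SN _ _] eS] /eqP <-] ->].
by rewrite val_half // even_halfK // eqxx.
Qed.

(** The term k^2 / N is s = 1. The constant 52 is 4 + 48: s = 2 gives 4 from N^2 <= 4 C(N, 2), and
    each of the at most N values s >= 3 costs 48 / N^3, since C(N, s) >= C(N, 3) in the range 2s <=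
    N. *)
Lemma sum_weight_le : 6 <= N ->
  N ^ 2 * \sum_(S : {set V} | [&& #|S| <= N, S :&: W != set0 & ~~ (W \subset S)]) weight S
    <= (N * k ^ 2 + 52 * 2 ^ k) * P.
Proof.
move=> hN; apply: leq_trans (leq_mul (leqnn _) sum_weight_layers) _.
have bin2N : N ^ 2 <= 4 * 'C(N, 2).
  rewrite bin2; have := odd_double_half (N * N.-1); nia.
have bin3N : N ^ 3 <= 48 * 'C(N, 3).
  have := mul_bin_left N 2; have := mul_bin_left N 1; rewrite bin1; nia.
have tail s : 3 <= s -> N ^ 3 * (if (0 < s) && (s.*2 <= N) then layer s else 0)
    <= 48 * 2 ^ k * P.
  move=> s3; case: ifP => [/andP[_ sN]|_]; last by rewrite muln0.
  have le3 := leq_bin_half s3 sN; have := layer_le_exp s.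
  move: (layer s) (2 ^ k) => l x; nia.
rewrite -(big_mkord (fun s => (0 < s) && (s.*2 <= N)) layer) big_mkcond.
have [lt1 lt2] : 1 < N.+1 /\ 2 < N.+1 by lia.
have [le1 le2] : 1 < N /\ 3 < N by lia.
rewrite big_ltn // big_ltn // big_ltn // /= add0n.
rewrite le1 le2.
set t := \sum_(3 <= s < N.+1) _.
have ht : N ^ 2 * t <= 48 * 2 ^ k * P.
  rewrite -(@leq_pmul2l N); last lia.
  rewrite mulnA -expnS big_distrr /= -/t.
  apply: leq_trans (_ : \sum_(3 <= s < N.+1) 48 * 2 ^ k * P <= _).
    by rewrite big_nat [leqRHS]big_nat; apply: leq_sum => s /andP[s3 _]; exact: tail.
  by rewrite sum_nat_const_nat leq_mul2r; apply/orP; right; lia.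
have h1 : N ^ 2 * layer 1 <= N * k ^ 2 * P.
  have := layer1_le; nia.
have h2 : N ^ 2 * layer 2 <= 4 * 2 ^ k * P.
  have := layer_le_exp 2; nia.
rewrite !mulnDr mulnDl; move: h1 h2 ht.
set a := N ^ 2 * _; set b := N ^ 2 * _; set c := N ^ 2 * _.
by set d := N * _ * _; set e := 2 ^ k; nia.
Qed.

End ClosedSets.

(** * First moment over short circuits *)

Section ShortCircuits.
Variable N : nat.
Hypothesis N_ge6 : 6 <= N.
Implicit Types (w : {set {set halfedge N}}).

(** Union bound over the sets of [separating_closed_set]: the matchings that contain the walk and
    keep [S] closed number at most [weight S]. *)
Lemma card_separated_by (c : seq (step N)) : closed_walk c ->
  N ^ 2 * #|[set w in Omega N | (edges c \subset w) && separating w c]| <=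
    (N * size c ^ 2 + 52 * 2 ^ size c) * nmatchings (6 * N - 2 * size c).
Proof.
move=> cc; have cV : #|vertex N| = 2 * N by rewrite card_ord.
have := sum_weight_le (vertices c) cV N_ge6; rewrite card_vertices //.
apply: leq_trans; rewrite leq_mul2l; apply/orP; right.
pose F S := [set w in Omega N | edges c \subset w & [forall e in w :\: edges c,
  (e \subset halfedges_at S) || [disjoint e & halfedges_at S]]].
apply: (@leq_trans (\sum_(S : {set vertex N} | [&& #|S| <= N,
    S :&: vertices c != set0 & ~~ (vertices c \subset S)]) #|F S|)).
  apply: card_le_sum => w; rewrite inE => /and3P[wO cw /(separating_closed_set wO)[S [SN S0 S1 cl]]].
  by exists S; [apply/and3P | rewrite inE wO cw].
apply: leq_sum => S _.
apply: leq_trans (card_matchings_containing_closed _ _ _) _.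
have cX := card_halfedges_at S.
have cE := card_cover_edges cc.
have cEX := card_edges_halfedges S cc.
have cT : #|halfedge N| = 6 * N by rewrite card_ord.
have e1 : #|(setT :\: cover (edges c)) :&: halfedges_at S| =
    3 * #|S| - 2 * #|S :&: vertices c|.
  by rewrite setTD setIC -setDE cardsD cX setIC cEX.
rewrite /weight card_vertices // e1 leq_mul2l; apply/orP; right.
by rewrite cardsD e1 cardsD cardsT setTI cE cT.
Qed.

(** Divided by [nmatchings (6 * N)], this bounds the expected number of circuits of length k. With n
    = 6N, the hypothesis makes the loss factor 1 - k^2 / n at least 1/2. *)
Lemma card_closed_walks_nmatchings k : k ^ 2 <= 3 * N ->
  (12 * N) ^ k * nmatchings (6 * N - 2 * k) <= 2 * 2 ^ k * nmatchings (6 * N).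
Proof.
move=> hk; have := @nmatchings_removed_pairs (6 * N) k ltac:(nia).
rewrite -mul2n => h.
rewrite (_ : 12 * N = 2 * (6 * N)); last by lia.
rewrite expnMn.
move: h; set q := (6 * N) ^ k; set x := 2 ^ k; set a := nmatchings _; set b := nmatchings _ => h.
have {}h : q * a <= 2 * b.
  rewrite -(@leq_pmul2l (3 * N)); last lia.
  apply: (@leq_trans ((6 * N - k ^ 2) * q * a)); last by nia.
  by rewrite -[leqRHS]mulnA leq_mul2r; apply/orP; right; lia.
by rewrite -(mulnA x) (mulnC 2) -(mulnA x) leq_mul2l h orbT.
Qed.

(** Union bound over the K + 1 lengths k <= K and over the closed walks of each length, with k
    replaced by K in the resulting bounds. *)
Lemma card_short_separating K (A : {set {set {set halfedge N}}}) :
  K ^ 2 <= 3 * N ->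
  {in A, forall w, w \in Omega N /\
    exists c, [/\ circuit w c, separating w c & size c <= K]} ->
  N ^ 2 * #|A| <= K.+1 * (2 ^ K.+1 * (N * K ^ 2 + 52 * 2 ^ K) * #|Omega N|).
Proof.
move=> hK hA.
have cO : #|Omega N| = nmatchings (6 * N) by rewrite [LHS]card_matchings cardsT card_ord.
pose F k (c : k.-tuple (step N)) :=
  [set w in Omega N | (edges c \subset w) && separating w c].
pose G (k : 'I_K.+1) := \bigcup_(c : k.-tuple (step N) | closed_walk c) F k c.
apply: leq_trans (leq_mul (leqnn _) (@card_le_sum _ _ A xpredT G _)) _.
  move=> w /hA[wO [c [cw sc cK]]]; exists (Ordinal (cK : size c < K.+1)) => //.
  apply/bigcupP; exists (in_tuple c); first exact: circuit_closed_walk cw.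
  rewrite inE wO sc andbT; apply/subsetP => e; rewrite inE => /mapP[d dc ->].
  by case/and5P: cw => _ /allP/(_ d dc).
apply: (@leq_trans (\sum_(k < K.+1) 2 ^ K.+1 * (N * K ^ 2 + 52 * 2 ^ K) * #|Omega N|));
  last by rewrite sum_nat_const card_ord.
rewrite big_distrr; apply: leq_sum => -[k kK] _; rewrite [leqLHS]/=.
have kK2 : k ^ 2 <= K ^ 2 by rewrite leq_exp2r.
have kK' : 2 ^ k <= 2 ^ K by rewrite leq_exp2l.
have leF : #|G (Ordinal kK)| <= \sum_(c : k.-tuple (step N) | closed_walk c) #|F k c|.
  by apply: card_le_sum => w /bigcupP[c cc wc]; exists c.
apply: leq_trans (leq_mul (leqnn _) leF) _.
rewrite big_distrr /=.
apply: (@leq_trans (\sum_(c : k.-tuple (step N) | closed_walk c)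
   (N * k ^ 2 + 52 * 2 ^ k) * nmatchings (6 * N - 2 * k))).
  apply: leq_sum => c cc; have := card_separated_by cc.
  by rewrite size_tuple.
rewrite sum_nat_const -[#|_|]cardsE.
apply: leq_trans (leq_mul (card_closed_walks N k) (leqnn _)) _.
rewrite [leqLHS]mulnCA.
have := @card_closed_walks_nmatchings k ltac:(lia); rewrite -cO.
move: (_ ^ k * nmatchings _) #|Omega N| => a b h.
apply: leq_trans (leq_mul (leqnn _) h) _.
rewrite (expnS 2 K) [leqLHS]mulnA leq_mul2r; apply/orP; right.
rewrite [leqLHS]mulnC leq_mul //; first by rewrite leq_mul2l kK' orbT.
by apply: leq_add; rewrite leq_mul2l ?kK2 ?kK' orbT.
Qed.

End ShortCircuits.

(* Imported only here because classical_sets shadows names of finset.          *)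
From mathcomp Require Import boolp classical_sets reals topology normedtype.
From mathcomp Require Import sequences exp ring lra.

Import Order.TTheory GRing.Theory Num.Theory.
Import numFieldNormedType.Exports.
Local Open Scope classical_set_scope.
Local Open Scope ring_scope.

(** * Asymptotics in N *)

Section ProbabilityBound.
Variables (R : realType) (C : R).
Hypotheses (C_gt0 : 0 < C) (C_lt1 : C < 1).

Lemma ln2_gt0 : 0 < ln 2 :> R.
Proof. by apply: ln_gt0; rewrite ltr1n. Qed.

Lemma Prob_le_truncn (N : nat) : (6 <= N)%N ->
  let K := Num.truncn (C * log2 (N%:R : R)) in (K ^ 2 <= 3 * N)%N ->
  N%:R ^+ 2 * Prob R (@has_short_separating_circuit R C N) <=
    K.+1%:R * (2 ^+ K.+1 * (N%:R * K%:R ^+ 2 + 52 * 2 ^+ K)).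
Proof.
move=> N6 K hK; rewrite /Prob; set A := [set w in _ | _]%SET.
have hA := @card_short_separating N N6 K A hK.
have O_gt0 : (0 < #|Omega N|)%N.
  rewrite [#|_|](card_matchings [set: halfedge N]%SET) cardsT card_ord.
  by rewrite (_ : 6 * N = (3 * N).*2)%N ?nmatchings_double_gt0 //; lia.
rewrite [leLHS]mulrA ler_pdivrMr ?ltr0n //.
rewrite -!natrX -!natrM -!natrD -!natrM ler_nat -mulnA; apply: hA.
move=> w; rewrite inE => /andP[wO /asboolP[c [cc sc cK]]]; split=> //.
exists c; split=> //; rewrite truncn_ge_nat //.
by rewrite mulr_ge0 ?divr_ge0 ?ln_ge0 ?ler1n ?(ltW ln2_gt0) ?(ltW C_gt0) //; lia.
Qed.

(** With L = ln N, the bounds 2^K <= N^C <= N and K + 1 <= D L turn the counting estimate into 104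
    (D L)^3 / exp((1 - C) L), where 104 = 2 * 52. Bounding the exponential below by its fourth-order
    term leaves one factor L, and 2496 = 104 * 24. *)
Lemma Prob_le_ln (N : nat) : (6 <= N)%N -> 1 <= ln N%:R :> R ->
  Prob R (@has_short_separating_circuit R C N) <=
    2496 * ((ln 2)^-1 + 1) ^+ 3 / (1 - C) ^+ 4 / ln N%:R.
Proof.
move=> N6 L1; set L := ln N%:R in L1 *; set K := Num.truncn (C * log2 (N%:R : R)).
have sqr_le (x : R) : 0 <= x -> x ^+ 2 + 52 <= 52 * (x + 1) ^+ 2.
  by move=> x0; have := sqr_ge0 x; rewrite sqrrD1; lra.
have N0 : 0 < N%:R :> R by rewrite ltr0n; lia.
have d0 : 0 < 1 - C by rewrite subr_gt0.
have l2 := ln2_gt0.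
have L0 : 0 < L by lra.
have Ky : K%:R <= C * (L / ln 2).
  by rewrite truncn_le; apply: mulr_ge0; [|apply: divr_ge0]; exact: ltW.
have NE : N%:R = expR L :> R by rewrite lnK // posrE.
have pow2K : 2 ^+ K <= expR (C * L).
  rewrite -[2 ^+ K]lnK ?posrE ?exprn_gt0 // ler_expR lnXn // -[leLHS]mulr_natl.
  by rewrite -ler_pdivlMr // -mulrA.
have XN : expR (C * L) <= N%:R.
  by rewrite NE ler_expR ler_piMl // ltW.
have hK : (K ^ 2 <= 3 * N)%N.
  apply: leq_trans (sqr_le_3exp2 K) _; rewrite leq_mul2l /=.
  by rewrite -(ler_nat R) natrX; exact: le_trans XN.
have := Prob_le_truncn N6 hK; rewrite -/K; set p := Prob _ _ => hp.
have K1 : K.+1%:R <= ((ln 2)^-1 + 1) * L.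
  rewrite -natr1 mulrDl mul1r lerD //; apply: (le_trans Ky).
  rewrite [X in _ <= X]mulrC; apply: ler_piMl; last exact: ltW.
  by apply: divr_ge0; exact: ltW.
set D := (ln 2)^-1 + 1 in K1 *.
have hp1 : N%:R * p <= 104 * K.+1%:R ^+ 3 * expR (C * L).
  rewrite -(ler_pM2l N0) mulrA -expr2; apply: (le_trans hp).
  have K0 : 0 <= K%:R :> R by [].
  have X0 : 0 <= 2 ^+ K :> R by rewrite exprn_ge0.
  have hB : N%:R * K%:R ^+ 2 + 52 * 2 ^+ K <= N%:R * (52 * K.+1%:R ^+ 2) :> R.
    apply: (@le_trans _ _ (N%:R * (K%:R ^+ 2 + 52))).
      by rewrite mulrDr lerD2l mulrC ler_pM2r //; exact: le_trans XN.
    rewrite ler_pM2l // -[K.+1%:R]natr1; move: K0; exact: sqr_le.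
  have -> : N%:R * (104 * K.+1%:R ^+ 3 * expR (C * L)) =
     K.+1%:R * (2 * expR (C * L) * (N%:R * (52 * K.+1%:R ^+ 2))) by ring.
  apply: ler_wpM2l => //; apply: ler_pM => //.
  - exact: exprn_ge0.
  - by rewrite addr_ge0 ?mulr_ge0 ?exprn_ge0.
  - by rewrite exprS ler_pM2l.
have hp2 : p <= 104 * K.+1%:R ^+ 3 / expR ((1 - C) * L).
  rewrite ler_pdivlMr ?expR_gt0 // -(ler_pM2r (expR_gt0 (C * L))) -mulrA -expRD.
  by rewrite -mulrDl subrK mul1r -NE mulrC.
apply: (le_trans hp2); rewrite ler_pdivrMr ?expR_gt0 //.
have hexp : ((1 - C) * L) ^+ 4 / 24 <= expR ((1 - C) * L).
  have := @expR_ge1Dxn R ((1 - C) * L) 3 (ltW (mulr_gt0 d0 L0)).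
  by rewrite (_ : 4`!%:R = 24) //; apply: le_trans; rewrite lerDr.
have D0 : 0 < D by rewrite addr_gt0 ?invr_gt0.
apply: (@le_trans _ _ (104 * (D * L) ^+ 3)).
  by rewrite ler_pM2l // lerXn2r // nnegrE ltW // mulr_gt0.
have -> : 104 * (D * L) ^+ 3 =
   2496 * D ^+ 3 / (1 - C) ^+ 4 / L * (((1 - C) * L) ^+ 4 / 24).
  by field; rewrite !gt_eqF.
by rewrite ler_wpM2l // !divr_ge0 ?mulr_ge0 ?exprn_ge0 ?ltW.
Qed.

End ProbabilityBound.

Theorem theoremD (R : realType) (C : R) (C_gt0 : 0 < C) (C_lt1 : C < 1) :
  (fun N : nat => Prob R (@has_short_separating_circuit R C N)) @ \oo --> (0 : R).
Proof.
set B : R := 2496 * ((ln 2)^-1 + 1) ^+ 3 / (1 - C) ^+ 4.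
apply/cvgr0Pnorm_le => e e0; near=> N.
have N0 : 0 < N%:R :> R by rewrite ltr0n; near: N; exists 1%N.
have lnN r : expR r < N%:R -> r < ln N%:R :> R.
  by move=> h; rewrite -[r]expRK ltr_ln ?posrE ?expR_gt0.
have L1 : 1 < ln N%:R :> R by apply: lnN; near: N; exact: nbhs_infty_gtr.
(* This is the threshold beyond which the bound B / ln N drops below [e]. *)
have Le : B / e < ln N%:R by apply: lnN; near: N; exact: nbhs_infty_gtr.
rewrite ger0_norm ?divr_ge0 //.
apply: le_trans (Prob_le_ln C_gt0 C_lt1 _ (ltW L1)) _; first by near: N; exists 6%N.
rewrite ler_pdivrMr ?(lt_trans _ L1) // [leRHS]mulrC -ler_pdivrMr //.
exact: ltW.
Unshelve. all: end_near.
Qed.
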